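(* Let $p\in C^1([0,1];(0,+\infty))$, $r\in C^0([0,1];(0,+\infty))$, $q\in C^0([0,1])$ and real constants $g_0,v_0,g_1,v_1$ be such that (i) either $v_0>0$, or $v_0=0$ and $g_0<0$; (ii) either $v_1>0$, or $v_1=0$ and $g_1>0$; (iii) the Sturm-Liouville operator $A$ (with eigenvalues $\lambda_n$ and eigenfunctions $\phi_n$, see context) satisfies $\lambda_1>0$ and $\sum_{n=1}^{\infty}\lambda_n^{-1}\max_{0\le z\le 1}|\phi_n(z)|<+\infty$; (iv) there exist a function $\eta\in C^2([0,1];(0,+\infty))$ and a constant $\sigma>0$ such that $p(z)\eta''(z)+p'(z)\eta'(z)-q(z)\eta(z)=-\sigma r(z)\eta(z)$ for all $z\in[0,1]$, and moreover $g_0\eta(0)+v_0\eta'(0)<0$ and $g_1\eta(1)+v_1\eta'(1)>0$. Then for every $x_0\in C^2([0,1])$, $u\in C^1(\mathbb{R}_+\times[0,1])$ and $(d_0,d_1)\in\Phi(x_0,u)$ (see context), the unique solution $x\in C^0(\mathbb{R}_+\times[0,1])\cap C^1((0,+\infty)\times[0,1])$ of the boundary-value evolution problem (E) (see context) with initial condition $x_0$ satisfies, for all $t\ge0$, $$\|x[t]\|_{\infty,\eta}\le\max\left(e^{-\sigma t}\|x[0]\|_{\infty,\eta},\ \frac{\max_{0\le s\le t}|d_0(s)|}{|g_0\eta(0)+v_0\eta'(0)|},\ \frac{\max_{0\le s\le t}|d_1(s)|}{g_1\eta(1)+v_1\eta'(1)}\right)+\sigma^{-1}\max_{0\le s\le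 t}\left(\max_{0\le z\le1}\frac{|u(s,z)|}{\eta(z)}\right),$$ where $\|x[t]\|_{\infty,\eta}:=\max_{0\le z\le1}\frac{|x(t,z)|}{\eta(z)}$.
   Context: $\mathbb{R}_+=[0,+\infty)$. For a function $x$ on $\mathbb{R}_+\times[0,1]$, $x[t]$ denotes the profile $z\mapsto x(t,z)$. $L^2_r([0,1])$ is the space of (classes of) measurable $f:[0,1]\to\mathbb{R}$ with $\int_0^1 r(z)|f(z)|^2dz<+\infty$, with inner product $\int_0^1 r f g\,dz$. The Sturm-Liouville operator $A:D\to L^2_r([0,1])$ is $(Af)(z)=-\frac{1}{r(z)}(p(z)f'(z))'+\frac{q(z)}{r(z)}f(z)$, where $D$ is the set of all $f\in H^2(0,1)$ with $g_0f(0)+v_0f'(0)=g_1f(1)+v_1f'(1)=0$. Under (i), (ii) its eigenvalues are real and form an infinite increasing sequence $\lambda_1<\lambda_2<\cdots$ with $\lambda_n\to+\infty$; to each $\lambda_n$ corresponds exactly one (up to sign) normalized eigenfunction $\phi_n\in D\cap C^2([0,1])$, $A\phi_n=\lambda_n\phi_n$, and $\{\phi_n\}_{n\ge1}$ is an orthonormal basis of $L^2_r([0,1])$. Problem (E): the PDE $$\frac{\partial x}{\partial t}(t,z)=\frac{p(z)}{r(z)}\frac{\partial^2 x}{\partial z^2}(t,z)+\frac{p'(z)}{r(z)}\frac{\partial x}{\partial z}(t,z)-\frac{q(z)}{r(z)}x(t,z)+u(t,z),\quad (t,z)\in(0,+\infty)\times(0,1),$$ with boundary conditions, for all $t\ge0$,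 $g_0x(t,0)+v_0\frac{\partial x}{\partial z}(t,0)=d_0(t)$ and $g_1x(t,1)+v_1\frac{\partial x}{\partial z}(t,1)=d_1(t)$. A solution with initial condition $x_0$ is a function $x\in C^0(\mathbb{R}_+\times[0,1])\cap C^1((0,+\infty)\times[0,1])$ satisfying these, with $x[t]\in C^2([0,1])$ for all $t\ge0$ and $x(0,z)=x_0(z)$ for all $z\in[0,1]$. For $x_0\in C^2([0,1])$ and $u\in C^1(\mathbb{R}_+\times[0,1])$, $\Phi(x_0,u)\subseteq C^1(\mathbb{R}_+;\mathbb{R}^2)$ denotes the (non-empty) set of pairs $(d_0,d_1)$ for which problem (E) with initial condition $x_0$ has a unique solution. (It contains all $(d_0,d_1)\in C^2(\mathbb{R}_+;\mathbb{R}^2)$ with $d_0(0)=g_0x_0(0)+v_0x_0'(0)$, $d_1(0)=g_1x_0(1)+v_1x_0'(1)$.) *)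

(* Defs.v *)
From HB Require Import structures.
From mathcomp Require Import all_boot all_order all_algebra.
From mathcomp Require Import all_classical all_reals all_analysis.
Set Implicit Arguments.
Unset Strict Implicit.
Unset Printing Implicit Defensive.
Import Order.TTheory GRing.Theory Num.Theory.
Import numFieldNormedType.Exports.
Local Open Scope classical_set_scope.
Local Open Scope ring_scope.

(* Only the values of [f] on [I] matter; for an interval [I] the derivative is
   the one-sided one at an endpoint belonging to [I]. *)
Definition diffq_on (R : realType) (I : set R) (f : R -> R) (z : R) :=
  (f y - f z) / (y - z) @[y --> within I z^'].

Definition derivable_on (R : realType) (I : set R) (f : R -> R) (z : R) : Prop :=
  cvg (diffq_on I f z).

Definition derive_on (R : realType) (I : set R) (f : R -> R) (z : R) : R :=
  lim (diffq_on I f z).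

Fixpoint Ck_on (R : realType) (I : set R) (k : nat) (f : R -> R) : Prop :=
  {within I, continuous f} /\
  match k with
  | 0 => True
  | k'.+1 => (forall z, I z -> derivable_on I f z) /\ Ck_on I k' (derive_on I f)
  end.

Definition unit01 (R : realType) : set R := `[0, 1]%classic.
Definition Rplus (R : realType) : set R := `[0, +oo[%classic.
Definition Rpos (R : realType) : set R := `]0, +oo[%classic.
Arguments unit01 {R}.
Arguments Rplus {R}.
Arguments Rpos {R}.

Definition dz (R : realType) (f : R -> R) : R -> R := derive_on unit01 f.

Definition C0_prod (R : realType) (T I : set R) (f : R -> R -> R) : Prop :=
  {within T `*` I, continuous (fun tz : R * R => f tz.1 tz.2)}.

Definition C1_prod (R : realType) (T I : set R) (f : R -> R -> R) : Prop :=
  [/\ C0_prod T I f,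
      forall t z, T t -> I z -> derivable_on T (f ^~ z) t,
      forall t z, T t -> I z -> derivable_on I (f t) z,
      C0_prod T I (fun t z => derive_on T (f ^~ z) t) &
      C0_prod T I (fun t z => derive_on I (f t) z)].

(* Used only for continuous functions on nonempty compact intervals, where the
   supremum is attained. *)
Definition max_on (R : realType) (I : set R) (f : R -> R) : R :=
  sup [set f z | z in I].

Definition wsupnorm (R : realType) (eta f : R -> R) : R :=
  max_on unit01 (fun z => `|f z| / eta z).

Definition L2w (R : realType) (r f : R -> R) : Prop :=
  measurable_fun unit01 f /\
  (\int[@lebesgue_measure R]_(z in unit01) (r z * f z ^+ 2)%:E < +oo)%E.

Definition test_function (R : realType) (psi : R -> R) : Prop :=
  (forall n z, derivable (derive1n n psi) z 1) /\
  (exists a b : R, [/\ 0 < a, b < 1 &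
     forall z, ~ (a <= z <= b) -> psi z = 0]).

Definition weak_derivative (R : realType) (f g : R -> R) : Prop :=
  forall psi, test_function psi ->
    (\int[@lebesgue_measure R]_(z in unit01) (f z * derive1 psi z) =
     - \int[@lebesgue_measure R]_(z in unit01) (g z * psi z))%R.

Definition H2 (R : realType) (f : R -> R) : Prop :=
  exists f1 f2 : R -> R,
    [/\ L2w (cst 1) f, L2w (cst 1) f1, L2w (cst 1) f2,
        weak_derivative f f1 & weak_derivative f1 f2].

(* A class in H^2(0,1) is given by its C^1([0,1]) representative, which is what
   gives a meaning to the boundary values of f and f'. *)
Definition SL_domain (R : realType) (g0 v0 g1 v1 : R) (f : R -> R) : Prop :=
  [/\ Ck_on unit01 1 f, H2 f,
      g0 * f 0 + v0 * dz f 0 = 0 &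
      g1 * f 1 + v1 * dz f 1 = 0].

(* For f in H^2(0,1) and p in C^1([0,1]), p f' is absolutely continuous, so this
   pointwise formula is meaningful almost everywhere and represents A f. *)
Definition SL_op (R : realType) (p q r f : R -> R) (z : R) : R :=
  - (r z)^-1 * dz (fun y => p y * dz f y) z + q z / r z * f z.

Definition ae01 (R : realType) (P : R -> Prop) : Prop :=
  {ae @lebesgue_measure R, forall z, unit01 z -> P z}.

Definition SL_eigenpair (R : realType) (p q r : R -> R) (g0 v0 g1 v1 : R)
    (mu : R) (f : R -> R) : Prop :=
  [/\ SL_domain g0 v0 g1 v1 f, ~ ae01 (fun z => f z = 0) &
      ae01 (fun z => SL_op p q r f z = mu * f z)].

(* [lam n] and [phi n] are the (n+1)-st eigenvalue and eigenfunction: the index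
   starts at 0 instead of 1. *)
Definition SL_spectrum (R : realType) (p q r : R -> R) (g0 v0 g1 v1 : R)
    (lam : nat -> R) (phi : nat -> R -> R) : Prop :=
  [/\ forall n, lam n < lam n.+1,
      forall mu, (exists f, SL_eigenpair p q r g0 v0 g1 v1 mu f) <->
                 (exists n, mu = lam n),
      forall n, SL_eigenpair p q r g0 v0 g1 v1 (lam n) (phi n),
      forall n, Ck_on unit01 2 (phi n) &
      forall n, (\int[@lebesgue_measure R]_(z in unit01)
                   (r z * phi n z ^+ 2)%:E = 1)%E].

Record solution (R : realType) (p q r : R -> R) (g0 v0 g1 v1 : R)
    (x0 : R -> R) (u : R -> R -> R) (d0 d1 : R -> R) (x : R -> R -> R) : Prop := {
  sol_C0 : C0_prod Rplus unit01 x ;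
  sol_C1 : C1_prod Rpos unit01 x ;
  sol_C2 : forall t, 0 <= t -> Ck_on unit01 2 (x t) ;
  sol_pde : forall t z, 0 < t -> 0 < z < 1 ->
    derive_on Rpos (x ^~ z) t =
      p z / r z * dz (dz (x t)) z + dz p z / r z * dz (x t) z
      - q z / r z * x t z + u t z ;
  sol_bc0 : forall t, 0 <= t -> g0 * x t 0 + v0 * dz (x t) 0 = d0 t ;
  sol_bc1 : forall t, 0 <= t -> g1 * x t 1 + v1 * dz (x t) 1 = d1 t ;
  sol_init : forall z, 0 <= z <= 1 -> x 0 z = x0 z }.

(* A solution is a function on R_+ x [0,1]: uniqueness is agreement there. *)
Definition Phi (R : realType) (p q r : R -> R) (g0 v0 g1 v1 : R)
    (x0 : R -> R) (u : R -> R -> R) : set ((R -> R) * (R -> R)) :=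
  [set d | [/\ Ck_on Rplus 1 d.1, Ck_on Rplus 1 d.2 &
    exists2 x, solution p q r g0 v0 g1 v1 x0 u d.1 d.2 x &
      forall y, solution p q r g0 v0 g1 v1 x0 u d.1 d.2 y ->
        forall t z, 0 <= t -> 0 <= z <= 1 -> y t z = x t z]].

(* Main.v *)
Require Import Defs.
From HB Require Import structures.
From mathcomp Require Import all_boot all_order all_algebra.
From mathcomp Require Import all_classical all_reals all_analysis.
From mathcomp Require Import ring lra.
(** The estimate is a parabolic maximum principle for the weighted profile
    [x / eta].  Fix the final time [t] and compare [|x| / eta] on
    [[0, t] x [0, 1]] with the barrier

      B(s) = exp(- sigma s) A + U / sigma,
      A = max (M, exp(sigma t) E),

    where [M] bounds the initial datum, [U] bounds [|u| / eta], and [E] is the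
    larger of the two normalised boundary bounds.  The point of this [A] is that
    [B] is smooth although the right-hand side of the theorem is a maximum of
    two regimes: [B(0) >= M], [B >= E] on the whole of [[0, t]], and [B(t)] is
    exactly the bound to be proved.  Moreover [B' + sigma B = U].

    Suppose [w = k x / eta - B], with [k = 1] or [k = -1], has a positive maximum
    [w*] over the compact rectangle, attained at [(s, z)], and put
    [m = w* + B(s)].  Then [k x(s, .) <= m eta] on [[0, 1]], with equality at [z].
    - [s = 0] is excluded by [B(0) >= M].
    - At [z = 0] the touching gives [k x_z <= m eta']; as [v0 >= 0], the boundary
      condition forces [|d0(s)| >= m |g0 eta(0) + v0 eta'(0)|], which exceeds what
      [m > B(s) >= E] permits.  The point [z = 1] is symmetric.
    - For [0 < z < 1], [k x_z = m eta'] and [k x_zz <= m eta''], so the equation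
      for [eta] turns the PDE into [k x_t <= - sigma m eta + k u], while
      maximality in time gives [k x_t >= eta B'(s)].  Together they yield
      [m <= B(s)], a contradiction.
    Lemma [comparison] carries this argument for an arbitrary nonnegative
    differentiable barrier with [|u| <= (B' + sigma B) eta]. *)

Set Implicit Arguments.
Unset Strict Implicit.
Unset Printing Implicit Defensive.
Import Order.TTheory GRing.Theory Num.Theory.
Import numFieldNormedType.Exports.
Local Open Scope classical_set_scope.
Local Open Scope ring_scope.

(** * Maxima and derivatives relative to a set *)

(** A relational form of [derive_on]: it passes to linear combinations without
    any uniqueness of the limit, hence without knowing that the base point is an
    accumulation point of [I]. *)
Definition is_derive_on (R : realType) (I : set R) (f : R -> R) (z l : R) : Prop :=
  diffq_on I f z --> l.

Lemma derivable_onP (R : realType) (I : set R) (f : R -> R) (z : R) :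
  derivable_on I f z -> is_derive_on I f z (derive_on I f z).
Proof. by []. Qed.

Lemma is_derive_on_lin (R : realType) (I : set R) (f g : R -> R) (z a b k m : R) :
  is_derive_on I f z a -> is_derive_on I g z b ->
  is_derive_on I (fun y => k * f y - m * g y) z (k * a - m * b).
Proof.
rewrite /is_derive_on /diffq_on => fa gb.
have -> : (fun y => (k * f y - m * g y - (k * f z - m * g z)) / (y - z)) =
    (fun y => k * ((f y - f z) / (y - z)) - m * ((g y - g z) / (y - z))).
  by apply/funext => y; ring.
apply: cvgB; apply: cvgM; [exact: cvg_cst|exact: fa|exact: cvg_cst|exact: gb].
Qed.

Lemma is_derive_on_pos (R : realType) (I : set R) (f : R -> R) (z l : R) :
  is_derive_on I f z l -> 0 < l ->
  exists2 e, 0 < e & forall y, I y -> y != z -> `|y - z| < e ->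
    0 < (f y - f z) / (y - z).
Proof.
move=> fl l0.
have [e /= e0 H] : \forall y \near within I z^', 0 < (f y - f z) / (y - z).
  exact: (cvgr_gt _ fl _ l0).
exists e => // y Iy yz ye.
by apply: H => //=; rewrite /ball_/= distrC.
Qed.

(** Change of variable between the increment quotient of [is_derive] and the
    quotient of [diffq_on]; it gives access to the mean value theorem. *)
Lemma is_derive_dnbhsP (R : realType) (f : R -> R) (z l : R) :
  is_derive z 1 f l <-> (f y - f z) / (y - z) @[y --> z^'] --> l.
Proof.
rewrite is_derive1_caratheodory; split.
  move=> [g [fg /continuous_withinNx gz <-]].
  apply: cvg_trans gz; apply: near_eq_cvg.
  near=> y; rewrite fg mulfK// subr_eq0.
  by near: y; exact: nbhs_dnbhs_neq.
move=> fl; exists (fun y => if y == z then l else (f y - f z) / (y - z)).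
rewrite eqxx; split => //.
  move=> y; case: eqP => [->|/eqP yz]; first by rewrite !subrr mulr0.
  by rewrite divfK// subr_eq0.
apply/continuous_withinNx; rewrite eqxx; apply: cvg_trans fl; apply: near_eq_cvg.
near=> y; rewrite ifF//; apply/negbTE.
by near: y; exact: nbhs_dnbhs_neq.
Unshelve. all: by end_near. Qed.

Lemma is_derive_on_interior (R : realType) (I : set R) (f : R -> R) (z l : R) :
  nbhs z I -> is_derive_on I f z l -> is_derive z 1 f l.
Proof.
move=> Iz fl; apply/is_derive_dnbhsP.
apply: cvg_trans fl => A; rewrite /diffq_on /=.
move=> [e /= e0 H].
case: Iz => d /= d0 Hd.
exists (Num.min d e) => /=; first by rewrite lt_min d0.
move=> y /= ; rewrite lt_min => /andP[yd ye] yz.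
by apply: H => //; exact: Hd.
Qed.

Lemma is_derive_is_derive_on (R : realType) (I : set R) (f : R -> R) (z l : R) :
  is_derive z 1 f l -> is_derive_on I f z l.
Proof. by move=> /is_derive_dnbhsP fl; exact: cvg_within_filter. Qed.

Lemma point_right_of (R : realType) (z b e : R) : z < b -> 0 < e ->
  exists2 y, z < y <= b & y - z < e.
Proof.
move=> zb e0; have [be|eb] := ltP (b - z) e; first by exists b; rewrite ?zb ?lexx.
have e2 : e / 2 < e by rewrite ltr_pdivrMr// ltr_pMr// ltr1n.
exists (z + e / 2); last by rewrite addrAC subrr add0r.
by rewrite ltrDl divr_gt0//= -lerBrDl (le_trans (ltW e2)).
Qed.

(** Only a right neighbourhood of the maximum is used, so this applies at a left
    endpoint as well as inside an interval. *)
Lemma derive_on_max_right (R : realType) (I : set R) (f : R -> R) (z l b : R) :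
  is_derive_on I f z l -> z < b -> (forall y, z < y <= b -> I y) ->
  (forall y, z < y <= b -> f y <= f z) -> l <= 0.
Proof.
move=> fl zb Ib mx; rewrite leNgt; apply/negP => l0.
have [e e0 H] := is_derive_on_pos fl l0.
have [y zyb ye] := point_right_of zb e0; have /andP[zy yb] := zyb.
have : 0 < (f y - f z) / (y - z).
  by apply: H; [exact: Ib|rewrite gt_eqF|rewrite gtr0_norm ?subr_gt0].
by rewrite pmulr_lgt0 ?invr_gt0 ?subr_gt0// ltNge mx.
Qed.

Lemma derive_on_max_left (R : realType) (I : set R) (f : R -> R) (z l a : R) :
  is_derive_on I f z l -> a < z -> (forall y, a <= y < z -> I y) ->
  (forall y, a <= y < z -> f y <= f z) -> 0 <= l.
Proof.
move=> fl az Ia mx; rewrite leNgt; apply/negP => l0.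
have := is_derive_on_lin (k := 0) (m := 1) fl fl.
rewrite mul0r mul1r sub0r => /is_derive_on_pos; rewrite oppr_gt0 => /(_ l0)[e e0 H].
have Naz : - z < - a by rewrite ltrN2.
have [y' + ye] := point_right_of Naz e0.
rewrite ltrNl lerNr => /andP[yz ay]; pose y := - y'.
have : 0 < (0 * f y - 1 * f y - (0 * f z - 1 * f z)) / (y - z).
  apply: H; first by apply: Ia; rewrite ay yz.
    by rewrite lt_eqF.
  by move: ye; rewrite ltr0_norm ?subr_lt0// opprB /y !opprK addrC.
rewrite nmulr_lgt0 ?invr_lt0 ?subr_lt0// !mul0r !mul1r !sub0r ltrN2.
by rewrite ltNge mx// ay.
Qed.

(** Inside, both one-sided tests apply and [g z = 0].  If [l] were positive, [g]
    would be positive just to the right of [z], and by the mean value theorem [f]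
    would exceed its maximum there. *)
Lemma second_derivative_test (R : realType) (a b : R) (f g : R -> R) (z l : R) :
  {within `[a, b], continuous f} ->
  (forall y, a < y < b -> is_derive_on `[a, b] f y (g y)) ->
  a < z < b -> is_derive_on `[a, b] g z l ->
  (forall y, a <= y <= b -> f y <= f z) -> g z = 0 /\ l <= 0.
Proof.
move=> cf fg azb gl mx; have /andP[az zb] := azb.
have Iright y : z < y <= b -> a <= y <= b.
  by move=> /andP[zy ->]; rewrite (ltW (lt_trans az zy)).
have Ileft y : a <= y < z -> a <= y <= b.
  by move=> /andP[-> yz]; rewrite (ltW (lt_trans yz zb)).
have gz : g z = 0.
  have fz := fg z azb; apply/eqP; rewrite eq_le; apply/andP; split.
    apply: (derive_on_max_right fz zb) => y /Iright yI; last exact: mx.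
    by rewrite /= in_itv.
  apply: (derive_on_max_left fz az) => y /Ileft yI; last exact: mx.
  by rewrite /= in_itv.
split => //; rewrite leNgt; apply/negP => l0.
have [e e0 H] := is_derive_on_pos gl l0.
have [y zyb ye] := point_right_of zb e0; have /andP[zy yb] := zyb.
have [||c] := @MVT R f g z y zy.
- move=> c; rewrite in_itv/= => /andP[zc cy].
  have acb : a < c < b by rewrite (lt_trans az zc) (lt_le_trans cy yb).
  apply: (@is_derive_on_interior _ `[a, b]); last exact: fg.
  apply: (@filterS _ _ _ `]a, b[); first exact: subset_itv_oo_cc.
  by apply: near_in_itvoo; rewrite in_itv.
- apply: continuous_subspaceW cf => c /=; rewrite !in_itv/= => /andP[zc cy].
  by rewrite (le_trans (ltW az) zc) (le_trans cy yb).
rewrite in_itv/= => /andP[zc cy] fyz.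
have : 0 < (g c - g z) / (c - z).
  apply: H; last by rewrite gtr0_norm ?subr_gt0// (lt_trans _ ye)// ltrD2r.
    by rewrite /= in_itv/= Iright// zc (ltW (lt_le_trans cy yb)).
  by rewrite gt_eqF.
rewrite gz subr0 pmulr_lgt0 ?invr_gt0 ?subr_gt0// => gc.
have : f y - f z <= 0 by rewrite subr_le0 mx// Iright.
by rewrite fyz leNgt mulr_gt0// subr_gt0.
Qed.

(** * Continuity and suprema on compact sets *)

Lemma within_continuous_snd (R : realType) (T I : set R) (g : R -> R) :
  {within I, continuous g} -> {within T `*` I, continuous (fun p : R * R => g p.2)}.
Proof.
move=> /subspace_continuousP cg; apply/subspace_continuousP => -[t z] [/= Tt Iz].
have zV := cg z Iz; move=> V /zV /= nV.
have : \forall p \near (t, z), I p.2 -> V (g p.2).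
  exact: (@cvg_snd _ _ (nbhs t) (nbhs z) _ _ nV).
by apply: filterS => p IV [_ /IV].
Qed.

Lemma C0_prod_quotient (R : realType) (T I : set R) (f : R -> R -> R) (g : R -> R) :
  C0_prod T I f -> {within I, continuous g} -> (forall z, I z -> g z != 0) ->
  C0_prod T I (fun t z => f t z / g z).
Proof.
move=> /subspace_continuousP cf /(@within_continuous_snd _ T)/subspace_continuousP cg g0.
apply/subspace_continuousP => -[t z] [/= Tt Iz].
by apply: cvgM; [exact: cf|apply: cvgV; [exact: g0|exact: (cg (t, z))]].
Qed.

Lemma max_on_le (R : realType) (I : set R) (f : R -> R) (C : R) :
  I !=set0 -> (forall z, I z -> f z <= C) -> max_on I f <= C.
Proof.
move=> [z Iz] fC; apply: ge_sup; first by exists (f z), z.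
by move=> _ [y Iy <-]; exact: fC.
Qed.

(** The bound [C] matters: [sup] of an unbounded set is a default value. *)
Lemma le_max_on (R : realType) (I : set R) (f : R -> R) (C : R) :
  (forall z, I z -> f z <= C) -> forall z, I z -> f z <= max_on I f.
Proof.
move=> fC z Iz; apply: ub_le_sup; last by exists z.
by exists C => _ [y Iy <-]; exact: fC.
Qed.

Lemma compact_ubound (T : topologicalType) (R : realType) (K : set T) (f : T -> R) :
  compact K -> {within K, continuous f} -> exists C, forall z, K z -> `|f z| <= C.
Proof.
move=> cK /subspace_continuousP cf.
have [->|/set0P K0] := eqVneq K set0; first by exists 0.
have [|c _ fc] := @compact_EVT_max _ R (fun z => `|f z|) K K0 cK.
  by apply/subspace_continuousP => z Kz; apply: cvg_norm; exact: cf.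
by exists `|f c| => z Kz; apply: fc; rewrite inE.
Qed.

Lemma le_max_on_compact (R : realType) (K : set R) (f g : R -> R) (z : R) :
  compact K -> {within K, continuous f} -> {within K, continuous g} ->
  (forall z, K z -> 0 < g z) -> K z -> `|f z| / g z <= max_on K (fun y => `|f y| / g y).
Proof.
move=> cK /subspace_continuousP cf /subspace_continuousP cg g0.
have [|C hC] := @compact_ubound _ R K (fun y => f y / g y) cK.
  apply/subspace_continuousP => y Ky; apply: cvgM; first exact: cf.
  by apply: cvgV; [rewrite gt_eqF ?g0|exact: cg].
apply: (@le_max_on _ K (fun y => `|f y| / g y) C) => y Ky.
by have := hC y Ky; rewrite normrM normfV (gtr0_norm (g0 _ Ky)).
Qed.

(** * Touching profiles and the comparison principle *)

Lemma Ck_on_is_derive_on (R : realType) (I : set R) (k : nat) (f : R -> R) (z : R) :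
  Ck_on I k.+1 f -> I z -> is_derive_on I f z (derive_on I f z).
Proof. by move=> [_ [df _]]; exact: df. Qed.

Lemma Ck_on_pred (R : realType) (I : set R) (k : nat) (f : R -> R) :
  Ck_on I k.+1 f -> Ck_on I k f.
Proof.
elim: k f => [|k IH] f [cf [df cdf]]; first by [].
by split=> //; split=> //; exact: IH.
Qed.

(** First-order conditions when the profile [k f] touches its majorant [m g] at an
    endpoint: only the inward one-sided derivative is constrained, which is why
    the signs of [v0] and [v1] matter in the boundary conditions. *)
Lemma touching_endpoints (R : realType) (f g : R -> R) (k m : R) :
  Ck_on unit01 1 f -> Ck_on unit01 1 g ->
  (forall y, 0 <= y <= 1 -> k * f y <= m * g y) ->
  (k * f 0 = m * g 0 -> k * dz f 0 <= m * dz g 0) /\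
  (k * f 1 = m * g 1 -> m * dz g 1 <= k * dz f 1).
Proof.
move=> cf cg fg.
have I0 : @unit01 R 0 by rewrite /unit01/= in_itv/= lexx ler01.
have I1 : @unit01 R 1 by rewrite /unit01/= in_itv/= lexx ler01.
have dfg z (Iz : unit01 z) := is_derive_on_lin (k := k) (m := m)
  (Ck_on_is_derive_on cf Iz) (Ck_on_is_derive_on cg Iz).
split => eq; rewrite -subr_ge0 -oppr_le0 ?opprB.
  apply: (derive_on_max_right (dfg 0 I0) ltr01) => y /andP[/ltW y0 y1].
    by rewrite /unit01/= in_itv/= y0.
  by rewrite eq subrr subr_le0 fg// y0.
rewrite -oppr_ge0 opprB.
apply: (derive_on_max_left (dfg 1 I1) ltr01) => y /andP[y0 /ltW y1].
  by rewrite /unit01/= in_itv/= y0.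
by rewrite eq subrr subr_le0 fg// y0.
Qed.

Lemma touching_interior (R : realType) (f g : R -> R) (k m z : R) :
  Ck_on unit01 2 f -> Ck_on unit01 2 g -> 0 < z < 1 ->
  (forall y, 0 <= y <= 1 -> k * f y <= m * g y) -> k * f z = m * g z ->
  k * dz f z = m * dz g z /\ k * dz (dz f) z <= m * dz (dz g) z.
Proof.
move=> cf cg z01 fg eq.
have Iz y : 0 < y < 1 -> @unit01 R y.
  by move=> /andP[/ltW y0 /ltW y1]; rewrite /unit01/= in_itv/= y0.
have [[cf0 [_ cf1]] [cg0 [_ cg1]]] := (cf, cg).
have [|||||] := @second_derivative_test R 0 1 (fun y => k * f y - m * g y)
  (fun y => k * dz f y - m * dz g y) z (k * dz (dz f) z - m * dz (dz g) z).
- move: cf0 cg0 => /subspace_continuousP cf0 /subspace_continuousP cg0.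
  apply/subspace_continuousP => y Iy.
  by apply: cvgB; apply: cvgM; [exact: cvg_cst|exact: cf0|exact: cvg_cst|exact: cg0].
- move=> y /Iz yI; apply: is_derive_on_lin.
    exact: (Ck_on_is_derive_on cf yI).
  exact: (Ck_on_is_derive_on cg yI).
- exact: z01.
- apply: is_derive_on_lin.
    exact: (@Ck_on_is_derive_on _ _ 0 (dz f) z cf1 (Iz _ z01)).
  exact: (@Ck_on_is_derive_on _ _ 0 (dz g) z cg1 (Iz _ z01)).
- by move=> y y01; rewrite eq subrr subr_le0 fg.
by move=> /eqP; rewrite subr_eq0 subr_le0 => /eqP.
Qed.

(** The maximum principle for a barrier [B] that dominates the data.  The
    quotient [x / eta] only serves to locate the touching point; differentiating
    it is avoided by comparing [k x] with [m eta] for the constant [m].  The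
    factor [k] gives the upper and the lower bound at once. *)
Lemma comparison (R : realType) (p q r : R -> R) (g0 v0 g1 v1 : R) (eta : R -> R)
    (sigma : R) (x0 : R -> R) (u : R -> R -> R) (d0 d1 : R -> R) (x : R -> R -> R)
    (B dB : R -> R) (T k : R) :
  (forall z, 0 <= z <= 1 -> 0 < p z) -> (forall z, 0 <= z <= 1 -> 0 < r z) ->
  0 <= v0 -> 0 <= v1 ->
  Ck_on unit01 2 eta -> (forall z, 0 <= z <= 1 -> 0 < eta z) -> 0 < sigma ->
  (forall z, 0 <= z <= 1 ->
    p z * dz (dz eta) z + dz p z * dz eta z - q z * eta z <= - sigma * r z * eta z) ->
  g0 * eta 0 + v0 * dz eta 0 < 0 -> 0 < g1 * eta 1 + v1 * dz eta 1 ->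
  solution p q r g0 v0 g1 v1 x0 u d0 d1 x ->
  0 <= T -> `|k| <= 1 ->
  (forall t : R, is_derive t 1 B (dB t)) ->
  (forall t, 0 <= t <= T -> 0 <= B t) ->
  (forall z, 0 <= z <= 1 -> `|x 0 z| <= B 0 * eta z) ->
  (forall t, 0 <= t <= T -> `|d0 t| <= B t * `|g0 * eta 0 + v0 * dz eta 0|) ->
  (forall t, 0 <= t <= T -> `|d1 t| <= B t * (g1 * eta 1 + v1 * dz eta 1)) ->
  (forall t z, 0 <= t <= T -> 0 <= z <= 1 -> `|u t z| <= (dB t + sigma * B t) * eta z) ->
  forall t z, 0 <= t <= T -> 0 <= z <= 1 -> k * x t z <= B t * eta z.
Proof.
move=> p_gt0 r_gt0 v0_ge0 v1_ge0 eta2 eta_gt0 sigma_gt0 eta_ode c0 c1 sol T_ge0 k1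
  B' B0 Bx Bd0 Bd1 Bu.
have Iz y : 0 < y < 1 -> @unit01 R y.
  by move=> /andP[/ltW y0 /ltW y1]; rewrite /unit01/= in_itv/= y0.
have kle a : k * a <= `|a|.
  by apply: le_trans (ler_norm _) _; rewrite normrM ler_piMl.
pose w (tz : R * R) := k * (x tz.1 tz.2 / eta tz.2) - B tz.1.
pose K : set (R * R) := `[0, T] `*` unit01.
have K0 : K !=set0 by exists (0, 0); rewrite /K/unit01/= !in_itv/= !lexx T_ge0 ler01.
have cK : compact K by apply: compact_setX; exact: segment_compact.
have [|[t z] /set_mem[/=]] := @compact_EVT_max _ R w K K0 cK.
  have /subspace_continuousP cx : C0_prod `[0, T] unit01 (fun t z => x t z / eta z).
    apply: C0_prod_quotient; last 2 first.
    - by case: eta2.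
    - by move=> z; rewrite /unit01/= in_itv/= => z01; rewrite gt_eqF// eta_gt0.
    apply: continuous_subspaceW (sol_C0 sol) => -[t z] [/=]; rewrite /Rplus/= !in_itv/=.
    by move=> /andP[-> _].
  apply/subspace_continuousP => -[t z] Kz; apply: cvgB.
    by apply: cvgM; [exact: cvg_cst|exact: cx].
  apply: cvg_within_filter; apply: (@cvg_comp _ _ _ fst B _ (nbhs t)); first exact: cvg_fst.
  have /derivable1_diffP/differentiable_continuous : derivable B t 1 by exact: ex_derive.
  exact.
rewrite /unit01/= !in_itv/= => tT z01 wmax t' z' t'T z'01.
suff w_le0 : w (t, z) <= 0.
  have := le_trans (wmax (t', z') _) w_le0.
  rewrite inE /K/unit01/= !in_itv/= => /(_ (conj t'T z'01)).
  by rewrite /w subr_le0 mulrA ler_pdivrMr// eta_gt0.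
rewrite leNgt; apply/negP => w_gt0.
(* The level [m] makes [m * eta] the smallest multiple of [eta] above [k * x t]. *)
pose m := w (t, z) + B t.
have mB : B t < m by rewrite ltrDr.
have etaz := eta_gt0 z z01.
have touch : k * x t z = m * eta z.
  by rewrite /m /w subrK mulrA divfK// gt_eqF.
have below s y : 0 <= s <= T -> 0 <= y <= 1 -> k * x s y <= (w (t, z) + B s) * eta y.
  move=> sT y01; rewrite -ler_pdivrMr ?eta_gt0// -mulrA -lerBlDr.
  by apply: (wmax (s, y)); rewrite inE /K/unit01/= !in_itv.
have t_ge0 : 0 <= t by case/andP: tT.
have xt2 := sol_C2 sol t_ge0.
have [end0 end1] := touching_endpoints (Ck_on_pred xt2) (Ck_on_pred eta2)
  (fun y => below t y tT).
have [t0|t_neq0] := eqVneq t 0.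
  have := le_trans (kle _) (Bx z z01).
  by rewrite -t0 touch ler_pM2r// leNgt mB.
have t_gt0 : 0 < t by rewrite lt_neqAle eq_sym t_neq0.
have [z0|z_neq0] := eqVneq z 0.
  rewrite z0 in touch; have {end0} end0 := end0 touch.
  have bc : k * d0 t <= m * (g0 * eta 0 + v0 * dz eta 0).
    rewrite -(sol_bc0 sol t_ge0) !mulrDr !(mulrCA _ g0) !(mulrCA _ v0) touch lerD2l.
    exact: ler_wpM2l.
  have dle : - (k * d0 t) <= B t * `|g0 * eta 0 + v0 * dz eta 0|.
    by apply: le_trans (Bd0 t tT); rewrite -mulNr -(normrN (d0 t)) mulNr -mulrN kle.
  move: dle bc; rewrite ltr0_norm//; nra.
have [z1|z_neq1] := eqVneq z 1.
  rewrite z1 in touch; have {end1} end1 := end1 touch.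
  have bc : m * (g1 * eta 1 + v1 * dz eta 1) <= k * d1 t.
    rewrite -(sol_bc1 sol t_ge0) !mulrDr !(mulrCA _ g1) !(mulrCA _ v1) touch lerD2l.
    exact: ler_wpM2l.
  have := le_trans bc (le_trans (kle _) (Bd1 t tT)).
  by rewrite ler_pM2r// leNgt mB.
have z_in : 0 < z < 1.
  by rewrite !lt_neqAle eq_sym z_neq0 z_neq1; exact: z01.
have [x_z x_zz] := touching_interior xt2 eta2 z_in (fun y => below t y tT) touch.
(* The maximum over time may sit at [T], so only earlier times, here those of
   [t / 2, t[, are used. *)
have time : eta z * dB t <= k * derive_on Rpos (x ^~ z) t.
  have t_in : Rpos t by rewrite /Rpos/= in_itv/= t_gt0.
  have [_ dx _ _ _] := sol_C1 sol.
  have Dx := derivable_onP (dx t z t_in (Iz z z_in)).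
  have DB := is_derive_is_derive_on Rpos (B' t).
  have := is_derive_on_lin (k := k) (m := eta z) Dx DB.
  move=> /derive_on_max_left => /(_ (t / 2)); rewrite subr_ge0; apply.
  - by rewrite ltr_pdivrMr// ltr_pMr// ltr1n.
  - move=> s /andP[ts _]; rewrite /Rpos/= in_itv/= andbT.
    by apply: lt_le_trans ts; rewrite divr_gt0.
  - move=> s /andP[ts st]; rewrite touch.
    have sT : 0 <= s <= T.
      apply/andP; split; first by apply: le_trans ts; rewrite divr_ge0.
      by apply: le_trans (ltW st) _; case/andP: tT.
    by have := below s z sT z01; rewrite /m; lra.
have rz := r_gt0 z z01.
have pde : r z * derive_on Rpos (x ^~ z) t =
    p z * dz (dz (x t)) z + dz p z * dz (x t) z - q z * x t z + r z * u t z.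
  by rewrite (sol_pde sol)//; field; rewrite gt_eqF.
have m_ge0 : 0 <= m by apply: le_trans (ltW mB); exact: B0.
(* The PDE with [x_z], [x_zz] replaced by the touching conditions, and then the
   differential inequality for [eta] scaled by [m >= 0]. *)
have key : r z * (eta z * dB t) <=
    m * (- sigma * r z * eta z) + r z * ((dB t + sigma * B t) * eta z).
  apply: le_trans (ler_wpM2l (ltW rz) time) _.
  rewrite mulrCA pde.
  have -> : k * (p z * dz (dz (x t)) z + dz p z * dz (x t) z - q z * x t z + r z * u t z) =
     p z * (k * dz (dz (x t)) z) + dz p z * (k * dz (x t) z) - q z * (k * x t z)
     + r z * (k * u t z) by ring.
  rewrite x_z touch; apply: lerD; last first.
    by apply: ler_wpM2l; [exact: ltW|exact: le_trans (kle _) (Bu t z tT z01)].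
  apply: le_trans (ler_wpM2l m_ge0 (eta_ode z z01)).
  rewrite !mulrBr !mulrDr !(mulrCA m) lerD2r lerD2r.
  by rewrite ler_wpM2l// ltW// p_gt0.
have : 0 < r z * eta z * sigma * (m - B t).
  by rewrite !mulr_gt0// subr_gt0.
move: key; lra.
Qed.

(** * The exponential barrier *)

Lemma is_derive_exp_barrier (R : realType) (sigma A U s : R) :
  is_derive s 1 (fun s => expR (- sigma * s) * A + U) (- sigma * (expR (- sigma * s) * A)).
Proof.
have lin : is_derive s 1 (fun y : R => - sigma * y) (- sigma).
  by apply: is_derive_eq; rewrite [LHS]mulr1.
have ex := is_derive1_comp (is_derive_expR (- sigma * s)) lin.
have dB := is_deriveD (is_deriveM ex (is_derive_cst A s 1)) (is_derive_cst U s 1).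
apply: (is_derive_eq dB). rewrite scaler0 add0r addr0 /= /GRing.scale /=; ring.
Qed.

Theorem theorem2p2 (R : realType) (p q r : R -> R) (g0 v0 g1 v1 : R)
  (hp : Ck_on unit01 1 p) (hp_pos : forall z, 0 <= z <= 1 -> 0 < p z)
  (hr : Ck_on unit01 0 r) (hr_pos : forall z, 0 <= z <= 1 -> 0 < r z)
  (hq : Ck_on unit01 0 q)
  (h_i : 0 < v0 \/ (v0 = 0 /\ g0 < 0))
  (h_ii : 0 < v1 \/ (v1 = 0 /\ 0 < g1))
  (lam : nat -> R) (phi : nat -> R -> R)
  (h_spec : SL_spectrum p q r g0 v0 g1 v1 lam phi)
  (h_iii_pos : 0 < lam 0%N)
  (h_iii_sum : (\sum_(0 <= n <oo)
      ((lam n)^-1 * max_on unit01 (fun z => `|phi n z|))%:E < +oo)%E)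
  (eta : R -> R) (sigma : R)
  (heta : Ck_on unit01 2 eta) (heta_pos : forall z, 0 <= z <= 1 -> 0 < eta z)
  (hsigma : 0 < sigma)
  (h_iv_ode : forall z, 0 <= z <= 1 ->
      p z * dz (dz eta) z + dz p z * dz eta z - q z * eta z
      = - sigma * r z * eta z)
  (h_iv_bc0 : g0 * eta 0 + v0 * dz eta 0 < 0)
  (h_iv_bc1 : 0 < g1 * eta 1 + v1 * dz eta 1)
  (x0 : R -> R) (u : R -> R -> R) (d0 d1 : R -> R)
  (hx0 : Ck_on unit01 2 x0) (hu : C1_prod Rplus unit01 u)
  (hd : Phi p q r g0 v0 g1 v1 x0 u (d0, d1))
  (x : R -> R -> R) (hx : solution p q r g0 v0 g1 v1 x0 u d0 d1 x)
  (t : R) (ht : 0 <= t) :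
  wsupnorm eta (x t) <=
    Num.max (expR (- sigma * t) * wsupnorm eta (x 0))
      (Num.max
        (max_on `[0, t] (fun s => `|d0 s|) / `|g0 * eta 0 + v0 * dz eta 0|)
        (max_on `[0, t] (fun s => `|d1 s|) / (g1 * eta 1 + v1 * dz eta 1)))
    + sigma^-1 * max_on `[0, t] (fun s => max_on unit01 (fun z => `|u s z| / eta z)).
Proof.
have I0 : @unit01 R 0 by rewrite /unit01/= in_itv/= lexx ler01.
have v0_ge0 : 0 <= v0 by case: h_i => [/ltW//|[->]].
have v1_ge0 : 0 <= v1 by case: h_ii => [/ltW//|[->]].
have eta_gt0 z : unit01 z -> 0 < eta z.
  by rewrite /unit01/= in_itv/=; exact: heta_pos.
have ceta : {within unit01, continuous eta} by case: heta.
have c0 : 0 < `|g0 * eta 0 + v0 * dz eta 0| by rewrite normr_gt0 lt_eqF.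
have [[cd0 _] [cd1 _] _] := hd.
have c01 : compact (@unit01 R) by exact: segment_compact.
have ct : compact `[0, t] by exact: segment_compact.
have tRplus : `[0, t] `<=` @Rplus R.
  by move=> s; rewrite /Rplus/= !in_itv/= => /andP[-> _].
have I0t : `[0, t]%classic (0 : R) by rewrite /= in_itv/= lexx.
have bound_d (d : R -> R) : {within Rplus, continuous d} ->
    forall s, 0 <= s <= t -> `|d s| <= max_on `[0, t] (fun s => `|d s|).
  move=> /(continuous_subspaceW tRplus) /(compact_ubound ct)[C dC] s st.
  by apply: (le_max_on dC); rewrite /= in_itv.
(* Boundedness on the whole rectangle is what makes both nested suprema in the
   bound on [u] meaningful. *)
have [C uC] : exists C, forall s z, `[0, t]%classic s -> unit01 z -> `|u s z| / eta z <= C.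
  have [|C hC] := @compact_ubound _ R (`[0, t] `*` unit01) (fun sz => u sz.1 sz.2 / eta sz.2)
    (compact_setX ct c01).
    apply: (@C0_prod_quotient R) => //; last by move=> z /eta_gt0/gt_eqF->.
    have [cu _ _ _ _] := hu; apply: continuous_subspaceW cu => -[s z] [/=].
    by move=> /tRplus.
  exists C => s z st z01; have /= := hC (s, z) (conj st z01).
  by rewrite normrM normfV (gtr0_norm (eta_gt0 z z01)).
set M := wsupnorm eta (x 0).
set D0 := max_on _ (fun s => `|d0 s|); set D1 := max_on _ (fun s => `|d1 s|).
set U := max_on _ (fun s => max_on _ _).
set E0 := D0 / _; set E1 := D1 / _; set E := Num.max E0 E1.
(* The factor [expR (sigma * t)] keeps the barrier above [E] up to time [t], and
   is cancelled by the decay exactly at time [t]. *)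
pose A := Num.max M (expR (sigma * t) * E).
have D0_ge0 : 0 <= D0 by apply: le_trans (bound_d _ cd0 0 _); rewrite ?lexx.
have D1_ge0 : 0 <= D1 by apply: le_trans (bound_d _ cd1 0 _); rewrite ?lexx.
have E_ge0 : 0 <= E by rewrite le_max divr_ge0// ltW.
have uU s z : 0 <= s <= t -> 0 <= z <= 1 -> `|u s z| <= U * eta z.
  move=> st z01; rewrite -ler_pdivrMr ?heta_pos//.
  have Is : `[0, t]%classic s by rewrite /= in_itv.
  have Iz : unit01 z by rewrite /unit01/= in_itv.
  apply: le_trans (le_max_on (fun y => uC s y Is) Iz) _.
  apply: (@le_max_on _ _ (fun s => max_on unit01 (fun z => `|u s z| / eta z)) C) => //.
  by move=> s' Is'; apply: max_on_le; [exists 0|move=> y; exact: uC].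
have U_ge0 : 0 <= U.
  have := uU 0 0; rewrite !lexx ht ler01 => /(_ isT isT)/(le_trans (normr_ge0 _)).
  by rewrite pmulr_lge0// heta_pos// lexx ler01.
pose B s := expR (- sigma * s) * A + sigma^-1 * U.
have EB s : 0 <= s <= t -> E <= B s.
  move=> /andP[_ st]; rewrite /B -[E]addr0; apply: lerD; last first.
    by rewrite mulr_ge0// invr_ge0 ltW.
  apply: (@le_trans _ _ (expR (- sigma * s) * (expR (sigma * t) * E))).
    rewrite mulrA -expRD ler_peMl// -[leLHS]expR0 ler_expR mulNr addrC subr_ge0.
    by rewrite ler_wpM2l// ltW.
  by apply: ler_wpM2l; [exact: expR_ge0|rewrite le_max lexx orbT].
have Bt : B t = Num.max (expR (- sigma * t) * M) E + sigma^-1 * U.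
  by rewrite /B /A maxr_pMr ?expR_ge0// mulrA -expRD mulNr addNr expR0 mul1r.
rewrite -/E -Bt; apply: max_on_le; first by exists 0.
move=> z /[dup] Iz; rewrite /unit01/= in_itv/= => z01.
rewrite ler_pdivrMr ?eta_gt0//.
have cmp k : `|k| <= 1 -> k * x t z <= B t * eta z.
  move=> k1; apply: (@comparison R p q r g0 v0 g1 v1 eta sigma x0 u d0 d1 x B
    (fun s => - sigma * (expR (- sigma * s) * A)) t k) => //.
  - by move=> y y01; rewrite h_iv_ode.
  - by move=> s; exact: is_derive_exp_barrier.
  - by move=> s /EB; exact: le_trans.
  - move=> y y01; rewrite -ler_pdivrMr ?heta_pos//.
    have Iy : unit01 y by rewrite /unit01/= in_itv.
    have cx : {within unit01, continuous (x 0)} by have [] := sol_C2 hx (lexx 0).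
    apply: le_trans (le_max_on_compact c01 cx ceta eta_gt0 Iy) _.
    rewrite -/(wsupnorm eta (x 0)) -/M /B mulr0 expR0 mul1r -[M]addr0.
    by apply: lerD; [rewrite le_max lexx|rewrite mulr_ge0// invr_ge0 ltW].
  - move=> s st; rewrite -ler_pdivrMr//; apply: le_trans (EB s st).
    by rewrite le_max ler_pM2r ?invr_gt0// bound_d.
  - move=> s st; rewrite -ler_pdivrMr//; apply: le_trans (EB s st).
    by rewrite le_max ler_pM2r ?invr_gt0// bound_d// orbT.
  - move=> s y st y01; apply: le_trans (uU s y st y01) _.
    have -> : - sigma * (expR (- sigma * s) * A) + sigma * B s = U; last by [].
    by rewrite /B; field; rewrite gt_eqF.
  - by rewrite ht lexx.
rewrite ler_norml; apply/andP; split.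
  by rewrite lerNl -mulN1r cmp// normrN normr1.
by rewrite -[leLHS]mul1r cmp// normr1.
Qed.
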